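(* Let $R$ be a ring. The following are equivalent: (1) $R$ is a semi-regular 2-$\Delta U$ ring. (2) $R$ is an exchange 2-$\Delta U$ ring. (3) $R$ is a semi-tripotent ring.
   Context: Rings are associative with identity, not necessarily commutative. $U(R)$ is the group of units of $R$ and $J(R)$ the Jacobson radical. $\Delta(R)=\{r\in R : r+U(R)\subseteq U(R)\}$. A ring $R$ is called 2-$\Delta U$ if $u^2\in 1+\Delta(R)$ for every $u\in U(R)$. $R$ is semi-regular if $R/J(R)$ is von Neumann regular and idempotents lift modulo $J(R)$. $R$ is exchange if for each $a\in R$ there exists $e^2=e\in aR$ such that $1-e\in(1-a)R$. $R$ is semi-tripotent if every $a\in R$ can be written $a=e+j$ with $e^3=e$ and $j\in J(R)$ (equivalently, $R/J(R)$ satisfies the identity $x^3=x$ and idempotents lift modulo $J(R)$). *)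

(* Defs.v *)
From HB Require Import structures.
From mathcomp Require Import all_boot all_order all_algebra.
From mathcomp Require Import boolp classical_sets.

Set Implicit Arguments.
Unset Strict Implicit.
Unset Printing Implicit Defensive.

Import GRing.Theory.

Local Open Scope ring_scope.
Local Open Scope classical_set_scope.
Local Open Scope quotient_scope.

(* Rings are [pzRingType]s: associative, with identity, not necessarily       *)
(* commutative; the zero ring is allowed.  Units are defined by the existence *)
(* of a two-sided inverse, since [unitRingType] would exclude the zero ring   *)
(* and require a given decision procedure and inverse function.               *)

Section Ideals.
Variable R : pzRingType.

Definition units : set R := [set u | exists v, u * v = 1 /\ v * u = 1].

Definition left_ideal (I : set R) : Prop :=
  [/\ I 0, forall x y, I x -> I y -> I (x - y)
    & forall a x, I x -> I (a * x)].

Definition maximal_left_ideal (M : set R) : Prop :=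
  [/\ left_ideal M, ~ M 1
    & forall I : set R, left_ideal I -> M `<=` I -> ~ I 1 -> I = M].

Definition jacobson_radical : set R := \bigcap_(M in maximal_left_ideal) M.

Definition Delta : set R :=
  [set r | forall u, units u -> units (r + u)].

Lemma jacobson_radical_left_ideal : left_ideal jacobson_radical.
Proof.
split=> [M [[]]//|x y Jx Jy M Mmax|a x Jx M Mmax]; have [[_ MB MM] _ _] := Mmax.
- by apply: MB; [exact: Jx|exact: Jy].
- by apply: MM; exact: Jx.
Qed.

Lemma jacobson_radicalMr x a :
  jacobson_radical x -> jacobson_radical (x * a).
Proof.
move=> Jx M Mmax; have [[M0 MB MM] M1 Mm] := Mmax.
have [Ma|nMa] := pselect (M a); first exact: MM.
(* the left ideal (M : a) is again maximal *)
suff /Jx: maximal_left_ideal [set y | M (y * a)] by [].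
split=> [||I [I0 IB IM] sub nI1].
- split=> /= [|y z My Mz|b y My]; first by rewrite mul0r.
    by rewrite mulrBl; exact: MB.
  by rewrite -mulrA; exact: MM.
- by rewrite /= mul1r.
apply/seteqP; split=> // y Iy /=; apply: contrapT => nMya.
(* M + R y a is the whole ring *)
pose N := [set z | exists m b, M m /\ z = m + b * (y * a)].
have lN : left_ideal N.
  split=> [|z t [m [b [Mm1 ->]]] [n [c [Mn ->]]]|c z [m [b [Mm1 ->]]]].
  - by exists 0, 0; rewrite mul0r addr0.
  - exists (m - n), (b - c); split; first exact: MB.
    by rewrite mulrBl opprD addrACA.
  - by exists (c * m), (c * b); split; [exact: MM|rewrite mulrDr mulrA].
have MN : M `<=` N by move=> m Mm1; exists m, 0; rewrite mul0r addr0.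
have [[m [b [Mm1 E]]]|nN1] := pselect (N 1).
  apply: nI1.
  have Ic : I (1 - a * b * y).
    apply: sub; rewrite /= mulrBl mul1r -{1}[a]mulr1 E -!mulrA -mulrBr addrK.
    exact: MM.
  rewrite -[1](subrK (a * b * y)) -[X in _ + X]opprK; apply: (IB) => //.
  by rewrite -sub0r; apply: (IB) => //; exact: IM.
apply: nMya; rewrite -(Mm N lN MN nN1).
by exists 0, 1; rewrite mul1r add0r.
Qed.

End Ideals.

Section JacobsonQuotient.
Variable R : pzRingType.

Definition jacobson_pred (x : R) : bool := `[< jacobson_radical x >].

Lemma jacobson_pred_zmod_closed : zmod_closed jacobson_pred.
Proof.
have [J0 JB _] := jacobson_radical_left_ideal R.
by split=> [|x y /asboolP Jx /asboolP Jy]; apply/asboolP => //; exact: JB.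
Qed.

HB.instance Definition _ :=
  GRing.isZmodClosed.Build R jacobson_pred jacobson_pred_zmod_closed.

(* The additive quotient is the library's; the library only makes it a ring   *)
(* when R is commutative, so the multiplication is added here.                *)
Definition jacobson_quot :=
  {ideal_quot (GRing.ZmodClosed.clone R jacobson_pred _)}.

HB.instance Definition _ := GRing.Zmodule.on jacobson_quot.
HB.instance Definition _ := EqQuotient.on jacobson_quot.

Local Notation pi := (\pi_jacobson_quot).

Lemma jacobson_quot_eqP (x y : R) :
  pi x = pi y <-> jacobson_radical (x - y).
Proof.
split=> [/eqP|Jxy]; first by rewrite -Quotient.idealrBE => /asboolP.
by apply/eqP; rewrite -Quotient.idealrBE; apply/asboolP.
Qed.

Definition jacobson_quot_one : jacobson_quot := pi 1.
Definition jacobson_quot_mul := lift_op2 jacobson_quot *%R.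

Lemma jacobson_quot_piM x y : pi (x * y) = jacobson_quot_mul (pi x) (pi y).
Proof.
have [_ JB JM] := jacobson_radical_left_ideal R.
have JD (u v : R) : jacobson_radical u -> jacobson_radical v ->
    jacobson_radical (u + v).
  move=> Ju Jv; rewrite -[v]opprK; apply: (JB u (- v) Ju).
  by rewrite -mulN1r; exact: (JM (-1) v Jv).
unlock jacobson_quot_mul; apply/jacobson_quot_eqP.
set x' := repr (pi x); set y' := repr (pi y).
have Jx : jacobson_radical (x - x') by apply/jacobson_quot_eqP; rewrite reprK.
have Jy : jacobson_radical (y - y') by apply/jacobson_quot_eqP; rewrite reprK.
have -> : x * y - x' * y' = x * (y - y') + (x - x') * y'.
  by rewrite mulrBr mulrBl addrA subrK.
exact: (JD _ _ (JM x _ Jy) (jacobson_radicalMr _ Jx)).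
Qed.

Lemma jacobson_quot_piD x y : pi (x + y) = (pi x : jacobson_quot) + pi y.
Proof. exact: Quotient.pi_add. Qed.

Lemma jacobson_quot_mulA : associative jacobson_quot_mul.
Proof.
move=> x y z; rewrite -[x]reprK -[y]reprK -[z]reprK.
by rewrite -!jacobson_quot_piM mulrA.
Qed.

Lemma jacobson_quot_mul1r : left_id jacobson_quot_one jacobson_quot_mul.
Proof. by move=> x; rewrite -[x]reprK -jacobson_quot_piM mul1r. Qed.

Lemma jacobson_quot_mulr1 : right_id jacobson_quot_one jacobson_quot_mul.
Proof. by move=> x; rewrite -[x]reprK -jacobson_quot_piM mulr1. Qed.

Lemma jacobson_quot_mulDl : left_distributive jacobson_quot_mul +%R.
Proof.
move=> x y z; rewrite -[x]reprK -[y]reprK -[z]reprK.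
by rewrite -!(jacobson_quot_piD, jacobson_quot_piM) mulrDl.
Qed.

Lemma jacobson_quot_mulDr : right_distributive jacobson_quot_mul +%R.
Proof.
move=> x y z; rewrite -[x]reprK -[y]reprK -[z]reprK.
by rewrite -!(jacobson_quot_piD, jacobson_quot_piM) mulrDr.
Qed.

HB.instance Definition _ := GRing.Zmodule_isPzRing.Build jacobson_quot
  jacobson_quot_mulA jacobson_quot_mul1r jacobson_quot_mulr1
  jacobson_quot_mulDl jacobson_quot_mulDr.

End JacobsonQuotient.

Definition von_neumann_regular (S : pzRingType) : Prop :=
  forall a : S, exists x : S, a = a * x * a.

Section RingClasses.
Variable R : pzRingType.

Definition idempotents_lift_mod_jacobson : Prop :=
  forall a : jacobson_quot R, a ^+ 2 = a ->
  exists e : R, e ^+ 2 = e /\ \pi_(jacobson_quot R) e = a.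

Definition semi_regular : Prop :=
  von_neumann_regular (jacobson_quot R) /\ idempotents_lift_mod_jacobson.

Definition two_Delta_U : Prop :=
  forall u : R, units u -> exists2 d, Delta d & u ^+ 2 = 1 + d.

Definition exchange : Prop :=
  forall a : R, exists e : R,
    [/\ e ^+ 2 = e, exists x, e = a * x & exists y, 1 - e = (1 - a) * y].

Definition semi_tripotent : Prop :=
  forall a : R, exists e j : R,
    [/\ a = e + j, e ^+ 3 = e & jacobson_radical j].

End RingClasses.

(* Main.v *)
(* For exchange + 2-Delta-U => semi-tripotent, work in S = R/J(R), which is again
   exchange and 2-Delta-U and in which every nonzero right ideal contains a
   nonzero idempotent.  A nonzero a with a^2 = 0 would then produce 2x2 matrix
   units in S, and the unit [[1,1],[1,0]] refutes 2-Delta-U; so S is reduced and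
   its idempotents are central.  Hence Delta(S) = 0 and every unit squares to 1.
   The exchange property at a and at -a splits 1 into central idempotents on
   each of which a^2 = 1 or a^2 = 2a = -2a, and reducedness gives a^3 = a.
   Finally a = f - g with f = 1 - (1 - a)^2 and g = f - a orthogonal idempotents,
   and orthogonal idempotents lift modulo J(R) in an exchange ring. *)
From HB Require Import structures.
Require Import Defs.
From mathcomp Require Import all_boot all_order all_algebra.
From mathcomp Require Import boolp classical_sets.

Set Implicit Arguments.
Unset Strict Implicit.
Unset Printing Implicit Defensive.

Import GRing.Theory.

Local Open Scope ring_scope.
Local Open Scope classical_set_scope.
Local Open Scope quotient_scope.

(** * Units and the Jacobson radical *)

Lemma units_left_right (R : pzRingType) (u v w : R) :
  v * u = 1 -> u * w = 1 -> units u.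
Proof.
move=> vu uw; exists w; split=> //.
by rewrite -vu -[in RHS](mulr1 v) -uw mulrA vu mul1r.
Qed.

Lemma units_mul_eq0 (R : pzRingType) (u x : R) : units u -> x * u = 0 -> x = 0.
Proof. by move=> [v [uv _]] xu; rewrite -(mulr1 x) -uv mulrA xu mul0r. Qed.

Lemma maximal_left_ideal_exists (R : pzRingType) (I : set R) :
  left_ideal I -> ~ I 1 -> exists2 M, maximal_left_ideal M & I `<=` M.
Proof.
move=> lI nI1.
(* Zorn_bigcup also quantifies over the empty chain, whence the union with I *)
pose P (X : set R) := left_ideal (I `|` X) /\ ~ (I `|` X) 1.
have [|A [[lA nA1] Amax]] := @Zorn_bigcup _ P.
  move=> F FP Ftot; have [I0 IB IM] := lI.
  have sub X : F X -> I `|` X `<=` I `|` \bigcup_(X in F) X.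
    by move=> FX x [Ix|Xx]; [left|right; exists X].
  split; last first.
    by move=> [//|[X FX X1]]; have [_ []] := FP X FX; right.
  split=> [|x y|a x].
  - by left.
  - case=> [Ix|[X FX Xx]] [Iy|[Y FY Yy]].
    + by left; exact: IB.
    + by have [[_ B _] _] := FP Y FY; apply: (sub Y FY); apply: B; [left|right].
    + by have [[_ B _] _] := FP X FX; apply: (sub X FX); apply: B; [right|left].
    + case: (Ftot X Y FX FY) => XY.
        have [[_ B _] _] := FP Y FY; apply: (sub Y FY).
        by apply: B; right=> //; exact: XY.
      have [[_ B _] _] := FP X FX; apply: (sub X FX).
      by apply: B; right=> //; exact: XY.
  - case=> [Ix|[X FX Xx]]; first by left; exact: IM.
    by have [[_ _ M] _] := FP X FX; apply: (sub X FX); apply: M; right.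
exists (I `|` A); last by move=> x; left.
split=> // N lN AN nN1; apply/seteqP; split=> //; apply: contrapT => nNA.
have IN : I `|` N = N by apply/setUidPr => x Ix; apply: AN; left.
apply: (Amax N); last by rewrite /P IN.
split=> [x Ax|NA]; first by apply: AN; right.
by apply: nNA => x Nx; right; exact: NA.
Qed.

(** If [1 - k] had no left inverse, a maximal left ideal would contain [1 - k] and [k]. A left
    inverse of [1 - j] is again of the form [1 - k] with [k] in the radical, so it is invertible on
    both sides. *)
Lemma jacobson_radical_units (R : pzRingType) (j : R) :
  jacobson_radical j -> units (1 - j).
Proof.
have [J0 JB JM] := jacobson_radical_left_ideal R.
have linv (k : R) : jacobson_radical k -> exists y, y * (1 - k) = 1.
  move=> Jk; apply: contrapT => ninv.
  have [||M Mmax sM] :=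
      @maximal_left_ideal_exists R [set z | exists y : R, z = y * (1 - k)].
  - split=> [|x y [b ->] [c ->]|a x [b ->]]; first by exists 0; rewrite mul0r.
      by exists (b - c); rewrite mulrBl.
    by exists (a * b); rewrite mulrA.
  - by move=> [y E]; apply: ninv; exists y.
  have [[M0 MB MM] nM1 _] := Mmax; apply: nM1.
  have M1k : M (1 - k) by apply: sM; exists 1; rewrite mul1r.
  rewrite -[1](subrK k) -[X in _ + X]opprK; apply: (MB) => //.
  by rewrite -sub0r; apply: (MB) => //; exact: Jk.
move=> Jj; have [y yj] := linv j Jj.
have yE : y = 1 - (- y * j).
  by rewrite mulNr opprK -{1}yj mulrBr mulr1 subrK.
have [z zy] := linv _ (JM (- y) _ Jj); rewrite -yE in zy.
have zE : z = 1 - j by rewrite -[LHS]mulr1 -[in LHS]yj mulrA zy mul1r.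
by exists y; rewrite -{1}zE.
Qed.

Lemma jacobson_radicalP (R : pzRingType) (a : R) :
  (forall x, exists y, y * (1 - x * a) = 1) -> jacobson_radical a.
Proof.
move=> inv M [[M0 MB MM] nM1 Mmax]; apply: contrapT => nMa.
have MD x y : M x -> M y -> M (x + y).
  move=> Mx My; rewrite -[y]opprK; apply: (MB) => //.
  by rewrite -sub0r; exact: MB.
pose N := [set z | exists m b : R, M m /\ z = m + b * a].
have lN : left_ideal N.
  split=> [|z t [m [b [Mm ->]]] [n [c [Mn ->]]]|c z [m [b [Mm ->]]]].
  - by exists 0, 0; rewrite mul0r addr0.
  - by exists (m - n), (b - c); split; [exact: MB|rewrite mulrBl opprD addrACA].
  - by exists (c * m), (c * b); split; [exact: MM|rewrite mulrDr mulrA].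
have MN : M `<=` N by move=> m Mm; exists m, 0; rewrite mul0r addr0.
have [[m [b [Mm E]]]|nN1] := pselect (N 1).
  have [y yE] := inv b; apply: nM1; rewrite -yE; apply: MM.
  by rewrite E addrK.
apply: nMa; rewrite -(Mmax N lN MN nN1).
by exists 0, 1; rewrite mul1r add0r.
Qed.

Lemma units_1mul_swap (R : pzRingType) (a b : R) :
  units (1 - a * b) -> exists y, y * (1 - b * a) = 1.
Proof.
(* Jacobson's formula: with [v] for the geometric series of [a * b], this is the series of
   [b * a]. *)
move=> [v [_ vab]]; exists (1 + b * v * a).
have E : b * v * a * (1 - b * a) = b * a.
  rewrite -!mulrA.
  have -> : a * (1 - b * a) = (1 - a * b) * a.
    by rewrite mulrBr mulrBl mulr1 mul1r mulrA.
  by rewrite (mulrA v) vab mul1r.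
by rewrite mulrDl mul1r E subrK.
Qed.

(* One-sided invertibility suffices because a right inverse of 1 - a x has
   again the form 1 - a x'. *)
Lemma jacobson_radical_right_inv (R : pzRingType) (a : R) :
  (forall x, exists y, (1 - a * x) * y = 1) -> jacobson_radical a.
Proof.
move=> rinv; apply: jacobson_radicalP => x; apply: units_1mul_swap.
have [y xy] := rinv x; exists y; split=> //.
have yE : y = 1 - a * (- (x * y)).
  by rewrite mulrN opprK mulrA -[in RHS]xy mulrBl mul1r subrK.
have [z] := rinv (- (x * y)); rewrite -yE => yz.
rewrite -[RHS]yz; congr (_ * _).
by rewrite -[LHS]mulr1 -[X in _ * X = _]yz mulrA xy mul1r.
Qed.

(** * The projection onto R/J(R) and properties inherited by the quotient *)

Definition jacobson_pi (R : pzRingType) (x : R) : jacobson_quot R :=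
  \pi_(jacobson_quot R) x.

Lemma jacobson_pi_is_zmod_morphism (R : pzRingType) :
  zmod_morphism (@jacobson_pi R).
Proof.
by move=> x y; apply: (addIr (jacobson_pi y)); rewrite subrK /jacobson_pi
  -jacobson_quot_piD subrK.
Qed.

Lemma jacobson_pi_is_monoid_morphism (R : pzRingType) :
  monoid_morphism (@jacobson_pi R).
Proof. by split=> // x y; exact: jacobson_quot_piM. Qed.

HB.instance Definition _ (R : pzRingType) :=
  GRing.isZmodMorphism.Build R (jacobson_quot R) (@jacobson_pi R)
    (@jacobson_pi_is_zmod_morphism R).
HB.instance Definition _ (R : pzRingType) :=
  GRing.isMonoidMorphism.Build R (jacobson_quot R) (@jacobson_pi R)
    (@jacobson_pi_is_monoid_morphism R).

Lemma jacobson_pi_surj (R : pzRingType) (a : jacobson_quot R) :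
  exists x, jacobson_pi x = a.
Proof. by exists (repr a); exact: reprK. Qed.

Lemma jacobson_pi_eq (R : pzRingType) (x y : R) :
  jacobson_pi x = jacobson_pi y <-> jacobson_radical (x - y).
Proof. exact: jacobson_quot_eqP. Qed.

Lemma jacobson_pi_eq0 (R : pzRingType) (x : R) :
  jacobson_pi x = 0 <-> jacobson_radical x.
Proof. by rewrite -(rmorph0 (@jacobson_pi R)) jacobson_pi_eq subr0. Qed.

Lemma jacobson_pi_eq1_units (R : pzRingType) (x : R) :
  jacobson_pi x = 1 -> units x.
Proof.
move=> x1; have -> : x = 1 - (1 - x) by rewrite subKr.
apply: jacobson_radical_units; apply/jacobson_pi_eq0.
by rewrite rmorphB rmorph1 /= x1 subrr.
Qed.

(** For a lift [v] of the inverse, [x * v] and [v * x] are 1 modulo the radical, hence units; [x]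
    then has inverses on both sides. *)
Lemma jacobson_pi_units (R : pzRingType) (x : R) :
  units (jacobson_pi x) <-> units x.
Proof.
split=> [[v' [xv vx]]|[v [xv vx]]]; last first.
  by exists (jacobson_pi v); rewrite -!rmorphM xv vx rmorph1.
have [v vE] := jacobson_pi_surj v'; rewrite -vE -!rmorphM in xv vx.
have [s [xvs _]] := jacobson_pi_eq1_units xv.
have [t [_ tvx]] := jacobson_pi_eq1_units vx.
apply: (@units_left_right _ _ (t * v) (v * s)); first by rewrite -mulrA.
by rewrite mulrA.
Qed.

Lemma jacobson_radical_Delta (R : pzRingType) :
  @jacobson_radical R `<=` @Delta R.
Proof.
move=> j Jj u /jacobson_pi_units uu; apply/jacobson_pi_units.
by have /jacobson_pi_eq0 j0 := Jj; rewrite rmorphD /= j0 add0r.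
Qed.

Lemma two_Delta_U_jacobson_quot (R : pzRingType) :
  two_Delta_U R -> two_Delta_U (jacobson_quot R).
Proof.
move=> DU u; have [v <-] := jacobson_pi_surj u => /jacobson_pi_units/DU[d Dd E].
exists (jacobson_pi d); last by rewrite -rmorphXn E rmorphD rmorph1.
move=> w; have [x <-] := jacobson_pi_surj w => /jacobson_pi_units/Dd dx.
by rewrite -rmorphD; apply/jacobson_pi_units.
Qed.

Lemma exchange_jacobson_quot (R : pzRingType) :
  exchange R -> exchange (jacobson_quot R).
Proof.
move=> ex a; have [b <-] := jacobson_pi_surj a.
have [e [ee [x ex1] [y ey]]] := ex b; exists (jacobson_pi e); split.
- by rewrite -rmorphXn ee.
- by exists (jacobson_pi x); rewrite -rmorphM -ex1.
- exists (jacobson_pi y).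
  by rewrite -(rmorph1 (@jacobson_pi R)) -!rmorphB -rmorphM ey.
Qed.

(** Contrapositive form, on principal right ideals, of: every nonzero right ideal contains a nonzero
    idempotent. *)
Definition semipotent (S : pzRingType) : Prop :=
  forall a : S,
    (forall x, (a * x) * (a * x) = a * x -> a * x = 0) -> a = 0.

(** If [a] generates no nonzero idempotent in the quotient, exchange at [a * x] returns [e = 0],
    which makes [1 - a * x] right invertible for every [x]. *)
Lemma exchange_semipotent (R : pzRingType) :
  exchange R -> semipotent (jacobson_quot R).
Proof.
move=> /exchange_jacobson_quot ex b; have [a <-] := jacobson_pi_surj b => H.
apply/jacobson_pi_eq0; apply: jacobson_radical_right_inv => x.
have [e [ee [y ey] [z ez]]] := ex (jacobson_pi (a * x)).
have e0 : e = 0.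
  have ey' : e = jacobson_pi a * (jacobson_pi x * y) by rewrite mulrA -rmorphM.
  by rewrite ey'; apply: H; rewrite -ey' -expr2.
have [z' zE] := jacobson_pi_surj z.
have: units ((1 - a * x) * z').
  apply: jacobson_pi_eq1_units.
  by rewrite rmorphM rmorphB rmorph1 /= zE -ez e0 subr0.
by move=> [s [E _]]; exists (z' * s); rewrite mulrA.
Qed.

(** * Reduced exchange rings *)

(* b and z are the off-diagonal units e12, e21 of a copy of the 2x2 matrices in
   the corner at p.  There v = [[1,1],[1,0]] satisfies v^2 = v + p, so that
   u = 1 - p + v is a unit with u^2 - 1 = v, although v + (1 - p - v) is not a
   unit unless p = 0. *)
Lemma two_Delta_U_no_matrix_units (S : pzRingType) (b z : S) :
  two_Delta_U S -> b * b = 0 -> z * z = 0 -> b * z * b = b -> z * b * z = z ->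
  b = 0.
Proof.
move=> DU bb zz bzb zbz.
have bzl : b * z * z = 0 by rewrite -mulrA zz mulr0.
have zbl : z * b * b = 0 by rewrite -mulrA bb mulr0.
pose p := b * z + z * b; pose v := p - z * b + b + z.
have vE : v = b * z + b + z by rewrite /v /p addrK.
have pb : p * b = b by rewrite /p mulrDl bzb zbl addr0.
have pz : p * z = z by rewrite /p mulrDl bzl zbz add0r.
have bp : b * p = b by rewrite /p mulrDr !mulrA bb mul0r add0r.
have zp : z * p = z by rewrite /p mulrDr !mulrA zz mul0r addr0.
have pp : p * p = p by rewrite {2}/p mulrDr !mulrA pb pz.
have pv : p * v = v by rewrite vE !mulrDr mulrA pb pz.
have vp : v * p = v by rewrite vE !mulrDl bp zp -mulrA zp.
have vb : v * b = b + z * b by rewrite vE !mulrDl bzb bb addr0.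
have vz : v * z = b * z by rewrite vE !mulrDl bzl zz add0r addr0.
have vv : v * v = v + p.
  rewrite {2}vE !mulrDr mulrA vb vz mulrDl zbz {1}vE /p.
  by rewrite [LHS](AC (2*2*1) ((1*3*2)*(5*4))).
have up : (1 - p + v) * p = v by rewrite mulrDl mulrBl mul1r pp subrr add0r.
have uv : (1 - p + v) * v = v + p.
  by rewrite mulrDl mulrBl mul1r pv subrr add0r.
have uu : (1 - p + v) * (1 - p + v) = 1 + v.
  by rewrite [LHS]mulrDr mulrBr mulr1 up uv addrK (addrC v) addrA subrK.
have uu' : (1 - p + v) * (1 - p + v - p) = 1.
  by rewrite mulrBr uu up addrK.
have u'u : (1 - p + v - p) * (1 - p + v) = 1.
  have pu : p * (1 - p + v) = v by rewrite mulrDr mulrBr mulr1 pp subrr add0r.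
  by rewrite mulrBl uu pu addrK.
have uU : units (1 - p + v) by exists (1 - p + v - p).
have wU : units (1 - p - v).
  (* In the corner at [p], [- v] has inverse [p - v] because [v * v = v + p]; adding [1 - p] gives
     [1 - v]. *)
  exists (1 - v); split.
    rewrite mulrBr mulr1 !mulrBl mul1r pv vv subrr sub0r.
    by rewrite opprK addrA !subrK.
  rewrite mulrBl mul1r !mulrBr mulr1 vp vv subrr sub0r.
  by rewrite opprK addrA !subrK.
have [d Dd uE] := DU _ uU.
have dE : d = v by apply: (addrI 1); rewrite -uE expr2.
have qU : units (1 - p).
  by have := Dd _ wU; rewrite dE addrC subrK.
have p0 : p = 0.
  by apply: (units_mul_eq0 qU); rewrite mulrBr mulr1 pp subrr.
by rewrite -pb p0 mul0r.
Qed.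

Lemma semipotent_reduced (S : pzRingType) :
  two_Delta_U S -> semipotent S -> forall a : S, a * a = 0 -> a = 0.
Proof.
move=> DU sp a aa; apply: sp => x axax.
have aal w : w * a * a = 0 by rewrite -mulrA aa mulr0.
have axax' w : w * a * x * a * x = w * a * x.
  by rewrite -!mulrA; congr (_ * _); rewrite !mulrA -[in RHS]axax !mulrA.
rewrite mulrA in axax.
pose b := a * x * a; pose y := x * a * x.
have bb : b * b = 0 by rewrite /b !mulrA aal !mul0r.
have byb : b * y * b = b by rewrite /b /y !mulrA !axax.
have yby : y * b * y = y by rewrite /b /y !mulrA !axax'.
have bx : b * x = a * x by rewrite /b axax.
(* This correction keeps [z * b = y * b], so [b] and [z] remain mutual generalized inverses, and
   [z * y = 0] yields [z * z = 0]. *)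
clearbody b y; pose z := y - y * y * b.
have zb : z * b = y * b by rewrite mulrBl -(mulrA _ b) bb mulr0 subr0.
have b0 : b = 0.
  apply: (@two_Delta_U_no_matrix_units _ b z) => //.
  - have zy : z * y = y * y - y * (y * b * y) by rewrite mulrBl !mulrA.
    rewrite yby subrr in zy.
    by rewrite {2}/z mulrBr !mulrA zy !mul0r subrr.
  - by rewrite -mulrA zb mulrA.
  - by rewrite zb mulrBr !mulrA yby.
by rewrite -bx b0 mul0r.
Qed.

(** The Peirce components [e * x * (1 - e)] and [(1 - e) * x * e] square to zero, so both vanish. *)
Lemma reduced_idempotent_central (S : pzRingType) (e x : S) :
  (forall a : S, a * a = 0 -> a = 0) -> e * e = e -> e * x = x * e.
Proof.
move=> red ee.
have c1e : (1 - e) * e = 0 by rewrite mulrBl mul1r ee subrr.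
have ce1 : e * (1 - e) = 0 by rewrite mulrBr mulr1 ee subrr.
have l : e * x * (1 - e) = 0.
  by apply: red; rewrite !mulrA -(mulrA (e * x)) c1e mulr0 !mul0r.
have r : (1 - e) * x * e = 0.
  by apply: red; rewrite !mulrA -(mulrA (_ * x)) ce1 mulr0 !mul0r.
move/eqP: l; rewrite mulrBr mulr1 subr_eq0 => /eqP ->.
by move/eqP: r; rewrite !mulrBl mul1r subr_eq0 => /eqP ->.
Qed.

(** The idempotent [k = x * e * a] satisfies [k * a = e * a], which forces [k = e]. Thus [x * e] is
    a two-sided inverse of [a * e] in the corner at [e], and [1 - e] fills the other corner. *)
Lemma reduced_corner_units (S : pzRingType) (a x e : S) :
  (forall a : S, a * a = 0 -> a = 0) -> a * x = e -> e * e = e ->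
  units (a * e + (1 - e)).
Proof.
move=> red ax ee.
have eC y := reduced_idempotent_central y red ee.
have c1e : (1 - e) * e = 0 by rewrite mulrBl mul1r ee subrr.
have ce1 : e * (1 - e) = 0 by rewrite mulrBr mulr1 ee subrr.
have c11 : (1 - e) * (1 - e) = 1 - e by rewrite mulrBr mulr1 c1e subr0.
pose k := x * e * a.
have kk : k * k = k.
  by rewrite /k !mulrA -(mulrA (x * e)) ax -(mulrA x) ee -(mulrA x) ee.
have kC y := reduced_idempotent_central y red kk.
have ke : k * e = k by rewrite -eC /k !mulrA eC -(mulrA x) ee.
have ka : k * a = e * a.
  by rewrite kC /k !mulrA ax ee.
have keE : x * e * a = e.
  apply/eqP; rewrite -/k -subr_eq0 -ke -[X in _ - X]ee -mulrBl -[X in _ * X]ax.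
  by rewrite mulrA mulrBl ka subrr mul0r.
have fe1 : 1 - e + e = 1 := subrK e 1.
move: (1 - e) c1e ce1 c11 fe1 => f fe ef ff fe1.
have inv (c d : S) : c * e * d = e -> (c * e + f) * (d * e + f) = 1.
  move=> ced; rewrite mulrDl !mulrDr ff !mulrA ced ee -(mulrA c) ef mulr0 addr0.
  by rewrite -(mulrA f) -eC mulrA fe mul0r add0r addrC.
exists (x * e + f); split; apply: inv => //.
by rewrite -mulrA eC mulrA ax ee.
Qed.

(** For an idempotent [e = d * x], adding [d] to the unit [- d * e + (1 - e)] gives a unit
    annihilated by [e], so [e = 0]. *)
Lemma reduced_Delta_eq0 (S : pzRingType) (d : S) :
  (forall a : S, a * a = 0 -> a = 0) -> semipotent S -> Delta d -> d = 0.
Proof.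
move=> red sp Dd; apply: sp => x; set e := d * x => ee.
have eC y := reduced_idempotent_central y red ee.
have : units (- d * e + (1 - e)).
  by apply: (@reduced_corner_units _ _ (- x)) => //; rewrite mulrNN.
move=> /Dd U; apply: (units_mul_eq0 U).
rewrite !mulrDr mulNr mulrN mulrN mulr1 ee subrr addr0.
by rewrite mulrA eC -mulrA ee subrr.
Qed.

Lemma exchange_reduced_sqr (S : pzRingType) (a : S) :
  (forall a : S, a * a = 0 -> a = 0) -> (forall u : S, units u -> u * u = 1) ->
  exchange S ->
  exists e : S,
    [/\ e * e = e, a * a * e = e & a * a * (1 - e) = (a + a) * (1 - e)].
Proof.
move=> red sq ex; have [e [ee2 [x ax] [y ay]]] := ex a.
have ee : e * e = e by rewrite -expr2.
(* The unit [c * f + (1 - f)] squares to 1. This is used for [a] at [e] and for [1 - a] at [1 - e],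
   where it reads [a * a = a + a]. *)
have sqe (c z f : S) : c * z = f -> f * f = f -> c * c * f = f.
  move=> cz ff; have fC w := reduced_idempotent_central w red ff.
  have uf : (c * f + (1 - f)) * f = c * f.
    by rewrite mulrDl mulrBl mul1r ff subrr addr0 -mulrA ff.
  have := sq _ (reduced_corner_units red cz ff).
  move/(congr1 ( *%R^~ f)); rewrite /= mul1r -mulrA uf mulrDl mulrBl mul1r.
  rewrite [f * (c * f)]mulrA fC -(mulrA c f f) ff subrr addr0.
  by rewrite -mulrA (mulrA f) fC -(mulrA c f) ff mulrA.
exists e; split=> //; first by apply: (sqe _ x).
have ff : (1 - e) * (1 - e) = 1 - e.
  by rewrite mulrBr mulr1 mulrBl mul1r ee subrr subr0.
have := sqe (1 - a) y (1 - e) (esym ay) ff.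
move: (1 - e) => f /eqP; rewrite [_ * (1 - a)]mulrBr mulr1 !mulrBl !mul1r opprB.
rewrite -addrA -subr_eq0 addrAC subrr add0r addrC -addrA -opprD subr_eq0.
by rewrite mulrDl => /eqP.
Qed.

Lemma exchange_reduced_tripotent (S : pzRingType) (a : S) :
  (forall a : S, a * a = 0 -> a = 0) -> (forall u : S, units u -> u * u = 1) ->
  exchange S -> a * a * a = a.
Proof.
move=> red sq ex.
have [e [ee ae a1e]] := exchange_reduced_sqr a red sq ex.
have [g [gg ag a1g]] := exchange_reduced_sqr (- a) red sq ex.
rewrite mulrNN in ag a1g.
have eC y := reduced_idempotent_central y red ee.
have gC y := reduced_idempotent_central y red gg.
have e1C y : (1 - e) * y = y * (1 - e) by rewrite mulrBl mulrBr eC mul1r mulr1.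
have g1C y : (1 - g) * y = y * (1 - g) by rewrite mulrBl mulrBr gC mul1r mulr1.
have e11 : (1 - e) * (1 - e) = 1 - e.
  by rewrite mulrBr mulr1 mulrBl mul1r ee subrr subr0.
have g11 : (1 - g) * (1 - g) = 1 - g.
  by rewrite mulrBr mulr1 mulrBl mul1r gg subrr subr0.
(* The part of [a] outside both corners where its square is already 1; it will turn out to be
   zero. *)
pose c := a * ((1 - e) * (1 - g)).
have cc : c * c = a * a * ((1 - e) * (1 - g)).
  have tC y : (1 - e) * (1 - g) * y = y * ((1 - e) * (1 - g)).
    by rewrite -mulrA g1C mulrA e1C -mulrA.
  rewrite /c -mulrA [X in a * X]mulrA tC -!mulrA; congr (a * (a * _)).
  by rewrite (mulrA (1 - g)) g1C -(mulrA _ _ (1 - g)) g11 mulrA e11.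
have cc1 : c * c = c + c by rewrite cc mulrA a1e -mulrA mulrDl.
have cc2 : c * c = - (c + c).
  by rewrite cc -g1C mulrA a1g -mulrA g1C -opprD mulNr mulrDl.
have c2 : c + c = 0.
  apply: red; rewrite mulrDl mulrDr.
  by rewrite {1 3}cc1 cc2 subrr addr0.
have c0 : c = 0 by apply: red; rewrite cc1.
pose q := a * a * a - a.
have qe : q * e = 0.
  by rewrite mulrBl -!mulrA (mulrA a a e) ae subrr.
have qg : q * g = 0.
  by rewrite mulrBl -!mulrA (mulrA a a g) ag subrr.
have q0 : q = 0.
  have <- : q * ((1 - e) * (1 - g)) = q.
    by rewrite mulrA (mulrBr q) mulr1 qe subr0 (mulrBr q) mulr1 qg subr0.
  by rewrite mulrBl -!mulrA -/c c0 !mulr0 subrr.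
by apply/eqP; rewrite -subr_eq0; apply/eqP.
Qed.

Lemma tripotent_orthogonal_split (S : pzRingType) (a : S) :
  a * a * a = a -> (1 - a) * (1 - a) * (1 - a) = 1 - a ->
  exists f g : S, [/\ f * f = f, g * g = g, f * g = 0, g * f = 0 & a = f - g].
Proof.
move=> a3 b3; set b := 1 - a in b3; pose f := 1 - b * b.
have fb : f * b = 0 by rewrite mulrBl mul1r b3 subrr.
have bf : b * f = 0 by rewrite mulrBr mulr1 mulrA b3 subrr.
have aE : a = 1 - b by rewrite /b subKr.
have fa : f * a = f by rewrite aE mulrBr mulr1 fb subr0.
have af : a * f = f by rewrite aE mulrBl mul1r bf subr0.
have ff : f * f = f by rewrite {2}/f mulrBr mulr1 mulrA fb mul0r subr0.
have fE : f = a + (a - a * a).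
  have ab : a * b = a - a * a by rewrite mulrBr mulr1.
  have bb : b * b = b - a * b by rewrite [LHS]mulrBl mul1r.
  by rewrite /f bb opprB addrCA -aE addrC ab.
(* Added to [fE], this gives [f + f = a + a * a], which is what the idempotency of [f - a]
   requires. *)
have afE : f = a * a - (a - a * a).
  by rewrite -{1}af {1}fE mulrDr mulrBr mulrA a3 opprB.
clearbody f; exists f, (f - a); split=> //; last by rewrite subKr.
- rewrite mulrBl !mulrBr ff fa af subrr sub0r opprB.
  by rewrite {1}afE subKr fE [RHS]addrC addKr.
- by rewrite mulrBr ff fa subrr.
- by rewrite mulrBl ff af subrr.
Qed.

(** * Lifting along the Jacobson radical *)

(** Modulo the radical, [e = a * x] gives [a * e = e], while [1 - e = (1 - a) * y] gives
    [a * (1 - e) = 0]. The factorization of [e] through [a] is kept to obtain orthogonality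
    later. *)
Lemma exchange_lift_idempotent (R : pzRingType) (a : R) :
  exchange R -> jacobson_pi (a * a) = jacobson_pi a ->
  exists e x : R, [/\ e * e = e, e = a * x & jacobson_pi e = jacobson_pi a].
Proof.
move=> ex aa; have [e [ee [x ax] [y ay]]] := ex a.
exists e, x; split=> //.
have ae : jacobson_pi (a * e) = jacobson_pi e.
  by rewrite ax mulrA rmorphM /= aa -rmorphM.
apply/eqP; rewrite -ae eq_sym -subr_eq0 -rmorphB -[X in X - _]mulr1 -mulrBr ay.
by rewrite mulrA mulrBr mulr1 rmorphM rmorphB /= aa subrr mul0r.
Qed.

Lemma exchange_lift_tripotent (R : pzRingType) (a : R) :
  exchange R -> (forall c : jacobson_quot R, c * c * c = c) ->
  exists2 e : R, e ^+ 3 = e & jacobson_pi e = jacobson_pi a.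
Proof.
move=> ex cube.
have [f' [g' [ff gg fg gf aE]]] :=
  tripotent_orthogonal_split (cube (jacobson_pi a)) (cube _).
have [f0 fE] := jacobson_pi_surj f'; have [g0 gE] := jacobson_pi_surj g'.
have [|f [_ [f2 _ pf]]] := exchange_lift_idempotent ex (a := f0).
  by rewrite rmorphM /= fE.
rewrite fE in pf.
(* Every right multiple of [g1], in particular the lifted [h], is killed by [f] on the left. *)
pose g1 := (1 - f) * g0 * (1 - f).
have pg1 : jacobson_pi g1 = g'.
  rewrite !rmorphM rmorphB rmorph1 /= pf gE mulrBl mul1r fg subr0.
  by rewrite mulrBr mulr1 gf subr0.
have [|h [x [h2 hE ph]]] := exchange_lift_idempotent ex (a := g1).
  by rewrite rmorphM /= pg1.
have fh : f * h = 0.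
  by rewrite hE /g1 !mulrA (mulrBr f) mulr1 f2 subrr !mul0r.
(* The right factor adds [k * f = 0]; since [f * h = 0], [k] is still idempotent. *)
pose k := h * (1 - f).
have fk : f * k = 0 by rewrite mulrA fh mul0r.
have kf : k * f = 0 by rewrite -mulrA mulrBl mul1r f2 subrr mulr0.
have k2 : k * k = k.
  by rewrite {1}/k -mulrA (mulrBl k) mul1r fk subr0 mulrA h2.
have pk : jacobson_pi k = g'.
  by rewrite rmorphM rmorphB rmorph1 /= ph pg1 pf mulrBr mulr1 gf subr0.
clearbody k.
exists (f - k); last by rewrite rmorphB /= pf pk.
have tt : (f - k) * (f - k) = f + k.
  by rewrite mulrBl !mulrBr f2 k2 fk kf subr0 sub0r opprK.
rewrite !exprS expr0 mulr1 tt mulrBl !mulrDr f2 k2 fk kf.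
by rewrite addr0 add0r.
Qed.

(** * Semi-regular, exchange and semi-tripotent rings *)

Lemma semi_regular_exchange (R : pzRingType) : semi_regular R -> exchange R.
Proof.
move=> [reg lift] a; have [x' axa] := reg (jacobson_pi a).
have [x xE] := jacobson_pi_surj x'.
have [e [e2 pe]] : exists e : R,
    e ^+ 2 = e /\ jacobson_pi e = jacobson_pi (a * x).
  by apply: lift; rewrite expr2 -!/(jacobson_pi _) rmorphM /= xE mulrA -axa.
rewrite expr2 in e2.
pose u := 1 - (e - a * x).
have pu : jacobson_pi u = 1 by rewrite !rmorphB rmorph1 /= pe subrr subr0.
have [v [uv vu]] := jacobson_pi_eq1_units pu.
have pv : jacobson_pi v = 1.
  by rewrite -(rmorph1 (@jacobson_pi R)) -uv rmorphM /= pu mul1r.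
have ue : u * e = a * x * e.
  by rewrite !mulrBl mul1r e2 subKr.
(* Conjugating e by u moves it into aR without changing its class. *)
pose f := u * e * v.
have f2 : f * f = f.
  by rewrite /f !mulrA -(mulrA (u * e)) vu mulr1 -(mulrA u) e2.
have pf : jacobson_pi f = jacobson_pi (a * x).
  by rewrite !rmorphM /= pu pv pe rmorphM mul1r mulr1.
have faE : f = a * (x * e * v) by rewrite /f ue !mulrA.
clearbody f; pose h := 1 - f.
have hh : h * h = h by rewrite mulrBr mulr1 mulrBl mul1r f2 subrr subr0.
(* Modulo the radical, [h * a] is [a - a * x * a = 0]. *)
have ph : jacobson_pi (1 - h * a) = 1.
  rewrite rmorphB rmorphM rmorphB rmorph1 /= pf rmorphM /= xE mulrBl mul1r.
  by rewrite -axa subrr subr0.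
have [y [hy _]] := jacobson_pi_eq1_units ph.
have hby : h * (1 - a) * y = h.
  have -> : h * (1 - a) = h * (1 - h * a) by rewrite !mulrBr mulrA hh.
  by rewrite -mulrA hy mulr1.
(* From [h * g = h] follow both the idempotency of [g] and [f * (1 - g) = 1 - g], which puts [1 - g]
   in [aR]. *)
pose g := (1 - a) * (y * h).
have hg : h * g = h by rewrite /g !mulrA hby hh.
have g2 : g * g = g by rewrite {1}/g -!mulrA hg.
exists (1 - g); split.
- by rewrite expr2 mulrBr mulr1 mulrBl mul1r g2 subrr subr0.
- exists (x * e * v * (1 - g)); rewrite mulrA -faE.
  have -> : f = 1 - h by rewrite /h subKr.
  by rewrite mulrBl mul1r mulrBr mulr1 hg subrr subr0.
- by exists (y * h); rewrite subKr.
Qed.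

Lemma exchange_semi_tripotent (R : pzRingType) :
  exchange R -> two_Delta_U R -> semi_tripotent R.
Proof.
move=> ex DU a.
have exS := exchange_jacobson_quot ex.
have DUS := two_Delta_U_jacobson_quot DU.
have spS := exchange_semipotent ex.
have redS := semipotent_reduced DUS spS.
have sqS (u : jacobson_quot R) : units u -> u * u = 1.
  move=> /DUS[d Dd]; rewrite expr2 => ->.
  by rewrite (reduced_Delta_eq0 redS spS Dd) addr0.
have [e e3 pe] := exchange_lift_tripotent a ex
  (fun c => exchange_reduced_tripotent c redS sqS exS).
exists e, (a - e); split=> //; first by rewrite addrC subrK.
by apply/jacobson_pi_eq.
Qed.

Lemma semi_tripotent_semi_regular (R : pzRingType) :
  semi_tripotent R -> semi_regular R.
Proof.
move=> tri.
have lift (a : jacobson_quot R) : exists2 e : R, e ^+ 3 = e & jacobson_pi e = a.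
  have [x <-] := jacobson_pi_surj a; have [e [j [-> e3 Jj]]] := tri x.
  exists e => //; rewrite rmorphD /=.
  by have /jacobson_pi_eq0 -> := Jj; rewrite addr0.
split=> a; have [e e3 <-] := lift a.
  by exists (jacobson_pi e); rewrite -!rmorphM -{1}e3 !exprS expr0 mulr1 mulrA.
(* The lift [e] is only tripotent; its square is idempotent and has the same class, as that class is
   idempotent. *)
move=> e2; exists (e ^+ 2); split.
  by rewrite -exprM (exprD e 3 1) e3 expr1 expr2.
by rewrite -[LHS]/(jacobson_pi _) rmorphXn.
Qed.

(** The tripotent part of a unit is a unit, so it squares to 1, and [u ^+ 2 - 1] lies in the
    radical. *)
Lemma semi_tripotent_two_Delta_U (R : pzRingType) :
  semi_tripotent R -> two_Delta_U R.
Proof.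
move=> tri u uU; have [e [j [uE e3 Jj]]] := tri u.
have pu : jacobson_pi u = jacobson_pi e.
  by apply/jacobson_pi_eq; rewrite uE addrC addKr.
have [v [ev _]] : units e.
  by apply/jacobson_pi_units; rewrite -pu; apply/jacobson_pi_units.
have e2 : e ^+ 2 = 1.
  by rewrite -[LHS]mulr1 -ev mulrA -exprSr e3.
exists (u ^+ 2 - 1); last by rewrite addrC subrK.
apply: jacobson_radical_Delta; apply/jacobson_pi_eq.
by rewrite rmorphXn /= pu -rmorphXn e2.
Qed.

Theorem theorem3p22 (R : pzRingType) :
  [<-> semi_regular R /\ two_Delta_U R;
       exchange R /\ two_Delta_U R;
       semi_tripotent R].
Proof.
tfae.
- by move=> [/semi_regular_exchange].
- by move=> [ex DU]; exact: exchange_semi_tripotent.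
- move=> tri; split; first exact: semi_tripotent_semi_regular.
  exact: semi_tripotent_two_Delta_U.
Qed.
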